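(* Let $X_1,X_2,\dots$ be independent random variables such that $\Pr\{0\le X_i\le1\}=1$ and $\mathbb{E}[X_i]=\mu_i$ for $i\in\mathbb{N}$. Define $S_n=\sum_{i=1}^nX_i$, $\overline{\mu}_n=\frac1n\sum_{i=1}^n\mu_i$, and $\mathcal{V}(s,n)=n\ln(\overline{\mu}_ne^s+1-\overline{\mu}_n)$ for $s\in\mathbb{R}$, $n\in\mathbb{N}$. Let $m$ be a positive integer with $0<\overline{\mu}_m<1$. Then for all $\theta\in(0,1)$, \[ \Pr\Big\{\sup_{n\in\mathbb{N}}\big[\zeta(S_n-m\theta)-\mathcal{V}(\zeta,n)+\mathcal{V}(\zeta,m)\big]\ge0\Big\}\le\Big[\exp\Big(\theta\ln\frac{\overline{\mu}_m}{\theta}+(1-\theta)\ln\frac{1-\overline{\mu}_m}{1-\theta}\Big)\Big]^m, \] where $\zeta=\ln\frac{\theta(1-\overline{\mu}_m)}{\overline{\mu}_m(1-\theta)}$.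
   Context: $\mathbb{N}$ denotes the set of positive integers. *)

(* Defs.v *)
From HB Require Import structures.
From mathcomp Require Import all_boot all_order all_algebra.
From mathcomp Require Import all_classical all_reals all_analysis.
Set Implicit Arguments. Unset Strict Implicit. Unset Printing Implicit Defensive.
Import Order.TTheory GRing.Theory Num.Theory.
Local Open Scope classical_set_scope.
Local Open Scope ring_scope.

(* Convention: the paper's X_1, X_2, ... are X 0, X 1, ... (X_{i+1} = X i),
   and similarly mu_{i+1} = mu i. *)

Definition independent_RVs {R : realType} {d : measure_display}
  {T : measurableType d} (P : probability T R) (X : nat -> T -> R) : Prop :=
  forall (s : seq nat) (B : nat -> set R),
    uniq s -> (forall i, i \in s -> measurable (B i)) ->
    P (\bigcap_(i in [set` s]) (X i @^-1` B i)) =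
    (\prod_(i <- s) P (X i @^-1` B i))%E.

Definition Ssum {R : realType} {T : Type} (X : nat -> T -> R) (n : nat) (w : T) : R :=
  \sum_(i < n) X i w.

Definition mubar {R : realType} (mu : nat -> R) (n : nat) : R :=
  n%:R^-1 * \sum_(i < n) mu i.

Definition Vfun {R : realType} (mu : nat -> R) (s : R) (n : nat) : R :=
  n%:R * ln (mubar mu n * expR s + 1 - mubar mu n).

(* Main.v *)
(** Put [zeta] fixed and [Y i = exp (zeta * X i) / (1 + mu i * (exp zeta - 1))].
    Convexity of [exp] gives [E (Y i) <= 1], so the products of the [Y i] form a
    nonnegative supermartingale, and AM-GM on the denominators shows that the
    n-th product is at least [exp (zeta * S_n - V(zeta, n))]. Ville's maximal
    inequality at level [exp (zeta * m * theta - V(zeta, m))] is the claim, since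
    [p * exp zeta + 1 - p = (1 - p) / (1 - theta)]. The supremum need not be
    attained, so the level is first lowered by [exp (- eps)] and [eps] sent to 0. *)
Require Import Defs.
From HB Require Import structures.
From mathcomp Require Import all_boot all_order all_algebra.
From mathcomp Require Import all_classical all_reals all_analysis.
From mathcomp Require Import ring lra measurable_realfun.
Import Order.TTheory GRing.Theory Num.Theory.
Local Open Scope classical_set_scope.
Local Open Scope ring_scope.
Set Implicit Arguments.
Unset Strict Implicit.

(** * Cylinder events, independence and factorisation of integrals *)

Definition cylinder {T : Type} {R : realType} (Y : nat -> T -> R)
    (s : seq nat) (B : nat -> set R) : set T :=
  \bigcap_(i in [set` s]) (Y i @^-1` B i).

Lemma cylinder_cons {T : Type} {R : realType} (Y : nat -> T -> R) k s B :
  cylinder Y (k :: s) B = Y k @^-1` B k `&` cylinder Y s B.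
Proof. by rewrite /cylinder !bigcap_seq big_cons. Qed.

Lemma cylinder1 {T : Type} {R : realType} (Y : nat -> T -> R) k B :
  cylinder Y [:: k] B = Y k @^-1` B k.
Proof. by rewrite cylinder_cons /cylinder bigcap_seq big_nil setIT. Qed.

Lemma measurable_superlevel {R : realType} {d : measure_display}
    {T : measurableType d} (f : T -> R) (c : R) :
  measurable_fun setT f -> measurable [set w | c <= f w].
Proof.
move=> mf; have := measurable_fun_ler (measurable_cst c) mf.
by move=> /(_ measurableT [set true]); rewrite setTI; exact.
Qed.

Section independence.
Context {R : realType} {d : measure_display} {T : measurableType d}.
Variable P : probability T R.

Lemma measurable_cylinder (Y : nat -> T -> R) (s : seq nat) (B : nat -> set R) :
  (forall i, measurable_fun setT (Y i)) ->
  (forall i, i \in s -> measurable (B i)) -> measurable (cylinder Y s B).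
Proof.
move=> mY mB; rewrite /cylinder; apply: fin_bigcap_measurable => //= i si.
by rewrite -[X in measurable X]setTI; apply: mY => //; exact: mB.
Qed.

(** As functions of [C], both sides are finite measures that agree on rectangles, a pi-system
    generating the product sigma-algebra. *)
Lemma indep_pair_event {d1 d2 : measure_display} {T1 : measurableType d1}
    {T2 : measurableType d2} (U : T -> T1) (V : T -> T2) (D : set T) :
  measurable_fun setT U -> measurable_fun setT V -> measurable D ->
  (forall A B, measurable A -> measurable B ->
    P (U @^-1` A `&` V @^-1` B `&` D) = (P (U @^-1` A `&` V @^-1` B) * P D)%E) ->
  forall C : set (T1 * T2), measurable C ->
    P ((fun w => (U w, V w)) @^-1` C `&` D) =
    (P ((fun w => (U w, V w)) @^-1` C) * P D)%E.
Proof.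
move=> mU mV mD UVD C mC.
have mUV : measurable_fun setT (fun w => (U w, V w)) by exact: measurable_fun_pair.
(* The measure structure on a pushforward takes the measurability proof as an
   argument, which [pose] abstracts: hence [m1_] and [m2_]. *)
pose m1_ : {measure set (T1 * T2) -> \bar R} :=
  pushforward (mrestr P mD) (fun w => (U w, V w)).
pose m1 := m1_ mUV.
have p0 : 0 <= fine (P D) by rewrite fine_ge0.
pose m2_ : {measure set (T1 * T2) -> \bar R} :=
  mscale (NngNum p0) (pushforward P (fun w => (U w, V w))).
pose m2 := m2_ mUV.
have m2E A : m2 A = (P ((fun w => (U w, V w)) @^-1` A) * P D)%E.
  by rewrite /m2 /= /mscale/= /pushforward muleC fineK// fin_num_measure.
rewrite -m2E; change (m1 C = m2 C).
pose G := [set A `*` B | A in @measurable _ T1 & B in @measurable _ T2].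
apply: (measure_unique G (fun=> setT)) => //.
- exact: measurable_prod_measurableType.
- move=> _ _ [A1 mA1 [B1 mB1 <-]] [A2 mA2 [B2 mB2 <-]].
  rewrite -setXI; exists (A1 `&` A2); first exact: measurableI.
  by exists (B1 `&` B2) => //; exact: measurableI.
- by move=> _; exists setT => //; exists setT => //; rewrite setXTT.
- by rewrite bigcup_const.
- by move=> _ [A mA [B mB <-]]; rewrite m2E -UVD.
- move=> _; apply: le_lt_trans (ltry 1).
  by apply: probability_le1; rewrite preimage_setT setTI.
Qed.

(** The hypothesis on rectangles makes the joint law of [U] and [V] the product of the marginal
    laws; Tonelli then splits the integral. *)
Lemma ge0_integral_mul_indep {d1 d2 : measure_display} {T1 : measurableType d1}
    {T2 : measurableType d2} (U : {mfun T >-> T1}) (V : {mfun T >-> T2})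
    (f : T1 -> \bar R) (g : T2 -> \bar R) :
  measurable_fun setT f -> measurable_fun setT g ->
  (forall x, (0 <= f x)%E) -> (forall x, (0 <= g x)%E) ->
  (forall A B, measurable A -> measurable B ->
    P (U @^-1` A `&` V @^-1` B) = (P (U @^-1` A) * P (V @^-1` B))%E) ->
  (\int[P]_w (f (U w) * g (V w)) = \int[P]_w f (U w) * \int[P]_w g (V w))%E.
Proof.
move=> mf mg f0 g0 UV.
have mUV : measurable_fun setT (fun w => (U w, V w)) by exact: measurable_fun_pair.
pose m_ : {measure set (T1 * T2) -> \bar R} := pushforward P (fun w => (U w, V w)).
pose m := m_ mUV.
pose h (z : T1 * T2) : \bar R := (f z.1 * g z.2)%E.
have mh : measurable_fun setT h.
  by apply: emeasurable_funM; exact: measurableT_comp.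
have h0 z : (0 <= h z)%E by rewrite mule_ge0.
have -> : (\int[P]_w (f (U w) * g (V w)) = \int[m]_z h z)%E.
  by rewrite ge0_integral_pushforward.
have -> : (\int[m]_z h z = \int[distribution P U \x distribution P V]_z h z)%E.
  apply: eq_measure_integral => A mA _; symmetry.
  by apply: product_measure_unique => // A1 B1 mA1 mB1; exact: UV.
rewrite fubini_tonelli1// /fubini_F /h /=.
under eq_integral => x _ do rewrite ge0_integralZl// ge0_integral_distribution//.
rewrite ge0_integralZr//; last by apply: integral_ge0 => w _; exact: g0.
by rewrite ge0_integral_distribution.
Qed.

End independence.

(** * Ville's inequality for products of independent nonnegative variables *)

Section maximal_inequality.
Context {R : realType} {d : measure_display} {T : measurableType d}.
Variables (P : probability T R) (Y : nat -> T -> R) (c : R).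
Hypothesis mY : forall i, measurable_fun setT (Y i).
Hypothesis Y0 : forall i w, 0 <= Y i w.
Hypothesis indepY : independent_RVs P Y.
Hypothesis EY : forall i, (\int[P]_w (Y i w)%:E <= 1)%E.
Hypothesis c0 : 0 < c.

(* The running product, set to 0 as soon as it reaches the level [c]: being a
   real-valued Markov state, it stays independent of the future [Y i] by
   induction, without introducing a filtration. *)
Definition stopped_step (z : R * R) : R :=
  let v := z.1 * z.2 in if v < c then v else 0.

Fixpoint stopped_prod (k : nat) : T -> R :=
  if k is k'.+1 then fun w => stopped_step (stopped_prod k' w, Y k' w)
  else fun=> 1.

(** First passage after [k.+1] factors: a past crossing leaves the state at 0, from which a positive
    [c] is never reached, so these events are disjoint. *)
Definition overshoot (k : nat) : set T := [set w | c <= stopped_prod k w * Y k w].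

Lemma measurable_stopped_step : measurable_fun setT stopped_step.
Proof.
have mM : measurable_fun setT (fun z : R * R => z.1 * z.2).
  by apply: measurable_funM.
apply: measurable_fun_ifT => //=; exact: measurable_fun_ltr.
Qed.

Lemma measurable_stopped_prod k : measurable_fun setT (stopped_prod k).
Proof.
elim: k => [|k IH] /=; first exact: measurable_cst.
apply: (measurableT_comp measurable_stopped_step).
exact: measurable_fun_pair.
Qed.

Lemma stopped_prod_ge0 k w : 0 <= stopped_prod k w.
Proof.
elim: k => [|k IH] /=; first exact: ler01.
by rewrite /stopped_step /=; case: ifP => // _; exact: mulr_ge0.
Qed.

(** Induction on [k]: the next state is a function of the current state and [Y k], and constraining
    [Y k] only prepends [k] to the cylinder. Hence whole lists of future indices in the
    statement. *)
Lemma stopped_prod_indep k s (B : nat -> set R) (A : set R) :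
  uniq s -> (forall i, i \in s -> (k <= i)%N) ->
  (forall i, i \in s -> measurable (B i)) -> measurable A ->
  P (stopped_prod k @^-1` A `&` cylinder Y s B) =
  (P (stopped_prod k @^-1` A) * P (cylinder Y s B))%E.
Proof.
elim: k s B A => [|k IH] s B A us sk mB mA.
  have [A1|A1] := pselect (A 1).
    have -> : stopped_prod 0 @^-1` A = setT by apply/seteqP; split => w /=.
    by rewrite setTI probability_setT mul1e.
  have -> : stopped_prod 0 @^-1` A = set0 by apply/seteqP; split => w /=.
  by rewrite set0I measure0 mul0e.
have mD := measurable_cylinder mY mB : measurable (cylinder Y s B).
apply: (@indep_pair_event _ _ _ P _ _ R R (stopped_prod k) (Y k) _
  (measurable_stopped_prod k) (mY k) mD _ (stopped_step @^-1` A)); last first.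
  by rewrite -[X in measurable X]setTI; exact: measurable_stopped_step.
move=> A1 B1 mA1 mB1.
(* Overriding [B] at [k] merges the constraint on [Y k] with those of [s] into one cylinder over
   [k :: s]. *)
pose B' i := if i == k then B1 else B i.
have ks : k \notin s by apply/negP => /sk; rewrite ltnn.
have B'B i : i \in s -> B' i = B i.
  by move=> si; rewrite /B'; case: eqP => // ik; move: si; rewrite ik (negbTE ks).
have mB' i : i \in k :: s -> measurable (B' i).
  rewrite inE => /orP[/eqP->|si]; first by rewrite /B' eqxx.
  by rewrite B'B//; exact: mB.
have tB' : cylinder Y s B' = cylinder Y s B.
  by apply: eq_bigcapr => i /= si; rewrite B'B.
have tkB' : cylinder Y (k :: s) B' = Y k @^-1` B1 `&` cylinder Y s B.
  by rewrite cylinder_cons tB' /B' eqxx.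
have tk : cylinder Y [:: k] (fun=> B1) = Y k @^-1` B1.
  by rewrite cylinder1.
have uks : uniq (k :: s) by rewrite /= ks.
(* The induction hypothesis separates the state from [k :: s] on the left and from [[:: k]] on the
   right; independence of [Y] does the rest. *)
rewrite -setIA -tkB' IH//; last first.
  by move=> i; rewrite inE => /orP[/eqP->//|/sk/ltnW].
rewrite -[in RHS]tk (IH [:: k])//; last first.
  by move=> i; rewrite inE => /eqP->.
rewrite -muleA; congr (_ * _)%E.
rewrite /cylinder indepY// big_cons.
rewrite indepY// indepY//.
rewrite big_cons big_nil mule1 /B' eqxx; congr (_ * _)%E.
by apply: eq_big_seq => i si; rewrite -/(B' i) B'B.
Qed.

(** The supermartingale step: the state is independent of [Y k], whose mean is at most 1. *)
Lemma integral_stopped_mul_le k :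
  (\int[P]_w (stopped_prod k w * Y k w)%:E <= \int[P]_w (stopped_prod k w)%:E)%E.
Proof.
pose U : {mfun T >-> R} :=
  HB.pack (stopped_prod k) (isMeasurableFun.Build _ _ _ _ _ (measurable_stopped_prod k)).
pose V : {mfun T >-> R} := HB.pack (Y k) (isMeasurableFun.Build _ _ _ _ _ (mY k)).
(* Factorisation asks for functions nonnegative on all of [R]; the absolute value is one, and is the
   identity on the values taken here. *)
pose f (x : R) : \bar R := (`|x|)%:E.
have mf : measurable_fun setT f by apply/measurable_EFinP; exact: normr_measurable.
have f0 x : (0 <= f x)%E by rewrite lee_fin.
have fU w : f (U w) = (stopped_prod k w)%:E 
  by congr (_%:E); apply: ger0_norm; exact: stopped_prod_ge0.
have fV w : f (V w) = (Y k w)%:E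
  by congr (_%:E); apply: ger0_norm; exact: Y0.
have := @ge0_integral_mul_indep _ _ _ P _ _ _ _ U V f f mf mf f0 f0.
have -> : (\int[P]_w (f (U w) * f (V w)) = \int[P]_w (stopped_prod k w * Y k w)%:E)%E.
  by apply: eq_integral => w _; rewrite fU fV EFinM.
have -> : (\int[P]_w (f (U w)) = \int[P]_w (stopped_prod k w)%:E)%E.
  by apply: eq_integral => w _; rewrite fU.
have -> : (\int[P]_w (f (V w)) = \int[P]_w (Y k w)%:E)%E.
  by apply: eq_integral => w _; rewrite fV.
move=> ->; last first.
  move=> A B mA mB.
  have := @stopped_prod_indep k [:: k] (fun=> B) A.
  rewrite cylinder1; apply => //.
  by move=> i; rewrite inE => /eqP->.
rewrite -[leRHS]mule1; apply: lee_wpmul2l => //.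
by apply: integral_ge0 => w _; rewrite lee_fin stopped_prod_ge0.
Qed.

Lemma measurable_overshoot k : measurable (overshoot k).
Proof.
apply: measurable_superlevel; apply: measurable_funM => //.
exact: measurable_stopped_prod.
Qed.

(* Optional stopping: the mass killed at step [j] is at least [c] on
   [overshoot j]. *)
Lemma stopped_prod_budget k :
  (\sum_(j < k) (c%:E * P (overshoot j)) + \int[P]_w (stopped_prod k w)%:E <= 1)%E.
Proof.
elim: k => [|k IH].
  by rewrite big_ord0 add0e /= integral_cst// mul1e; exact: probability_le1.
apply: le_trans IH; rewrite big_ord_recr /= -addeA; apply: leeD2l.
(* Passing to the integral of the product before truncation leaves a pointwise comparison. *)
apply: le_trans (integral_stopped_mul_le k).
have mo := measurable_overshoot k.
have mS := measurable_stopped_prod k.+1; rewrite /= in mS.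
have mI : measurable_fun setT (fun w => (\1_(overshoot k) w : R)%:E).
  by apply/measurable_EFinP; exact: measurable_indic.
have -> : (c%:E * P (overshoot k) = \int[P]_w (c%:E * (\1_(overshoot k) w)%:E))%E.
  rewrite ge0_integralZl//; last by rewrite lee_fin ltW.
  by rewrite integral_indic// setIT.
have mcI : measurable_fun setT (fun w => (c%:E * (\1_(overshoot k) w)%:E)%E).
  exact: emeasurable_funM.
rewrite -ge0_integralD//; last 3 first.
- by move=> w _; rewrite mule_ge0// lee_fin// ltW.
- by move=> w _; rewrite lee_fin (stopped_prod_ge0 k.+1).
- exact/measurable_EFinP.
apply: ge0_le_integral => //.
- move=> w _; rewrite -EFinM -EFinD lee_fin addr_ge0 ?mulr_ge0// ?(ltW c0)//.
  exact: (stopped_prod_ge0 k.+1).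
- by apply: emeasurable_funD => //; exact/measurable_EFinP.
- apply/measurable_EFinP; apply: measurable_funM => //; exact: measurable_stopped_prod.
- move=> w _; rewrite -EFinM -EFinD lee_fin /stopped_step /= indicE.
  case: ltP => H.
    by rewrite memNset ?mulr0 ?add0r// /overshoot /= leNgt H.
  by rewrite mem_set// mulr1 addr0.
Qed.

Lemma stopped_prodE k w : (forall j, (j < k)%N -> ~ overshoot j w) ->
  stopped_prod k w = \prod_(i < k) Y i w.
Proof.
elim: k => [|k IH] no; first by rewrite big_ord0.
have E : stopped_prod k w = \prod_(i < k) Y i w.
  by apply: IH => j jk; apply: no; exact: ltnW.
rewrite big_ord_recr /= -E /stopped_step /=.
by have /negP := no k (ltnSn k); rewrite -ltNge => ->.
Qed.

(** Reaching the level forces an overshoot, and the budget bounds each partial sum of overshoot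
    probabilities by [c^-1]. *)
Lemma maximal_inequality :
  (P (\bigcup_(n in [set n | (0 < n)%N]) [set w | (c <= \prod_(i < n) Y i w)%R])
   <= (c^-1)%:E)%E.
Proof.
set E := \bigcup_(_ in _) _.
(* Without any overshoot nothing is truncated, so a product of [n.+1] factors reaching [c] would
   itself be an overshoot at index [n]. *)
have EU : E `<=` \bigcup_j overshoot j.
  move=> w [[//|n] _ /= cn]; apply: contrapT => no.
  have no' j : ~ overshoot j w by move=> oj; apply: no; exists j.
  apply: (no' n); rewrite /overshoot /= stopped_prodE//.
  by rewrite big_ord_recr /= in cn.
have mprod n : measurable_fun setT (fun w => \prod_(i < n) Y i w).
  by apply: measurable_prod.
have mE : measurable E.
  by apply: bigcup_measurable => n _; exact: measurable_superlevel.
apply: (@le_trans _ _ (\sum_(0 <= j <oo) P (overshoot j))%E).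
  apply: measure_sigma_subadditive => //; exact: measurable_overshoot.
apply: lime_le.
  by apply: is_cvg_nneseries => n _ _.
near=> n.
have := stopped_prod_budget n.
rewrite -ge0_sume_distrr// big_mkord => h.
rewrite -(@lee_pmul2l _ c%:E)// -EFinM divff ?gt_eqF//.
apply: le_trans h; rewrite leeDl//.
by apply: integral_ge0 => w _; rewrite lee_fin stopped_prod_ge0.
Unshelve. all: by end_near.
Qed.

End maximal_inequality.

(** * Moment generating function of a variable in the unit interval *)

Lemma measurable_expRM {R : realType} {d : measure_display} {T : measurableType d}
    (z : R) (f : T -> R) :
  measurable_fun setT f -> measurable_fun setT (fun w => expR (z * f w)).
Proof.
move=> mf; apply: (measurableT_comp (@measurable_expR R)).
exact: (measurable_funM (measurable_cst z)).
Qed.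

(** Convexity of the exponential, [z * x] being the combination of [z] and 0 with weights [x] and
    [1 - x]. *)
Lemma expR_le_chord {R : realType} (z x : R) : 0 <= x <= 1 ->
  expR (z * x) <= 1 + x * (expR z - 1).
Proof.
case/andP => x0 x1.
have := convex_expR (Itv01 x0 x1) (z : R^o) (0 : R^o).
rewrite !convRE /= expR0 mulr0 addr0 mulr1 mulrC => /le_trans; apply.
by rewrite /unstable.onem mulrBr mulr1; lra.
Qed.

Section moment_generating.
Context {R : realType} {d : measure_display} {T : measurableType d}.
Variables (P : probability T R) (X : {RV P >-> R}) (mu : R).
Hypothesis X01 : P [set w | 0 <= X w <= 1] = 1%E.
Hypothesis EX : ('E_P[X] = mu%:E)%E.

(* [X] lies in [0, 1] only almost surely. *)
Let clamped w := Num.max 0 (Num.min (X w) 1).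

Let clamped01 w : 0 <= clamped w <= 1.
Proof. by rewrite /clamped le_max lexx /= ge_max ler01 ge_min lexx orbT. Qed.

Let mclamped : measurable_fun setT clamped.
Proof. by apply: measurable_maxr => //; exact: measurable_minr. Qed.

Let integral_clamped (f : R -> R) : measurable_fun setT f ->
  (\int[P]_w (f (X w))%:E = \int[P]_w (f (clamped w))%:E)%E.
Proof.
move=> mf; apply: ae_eq_integral => //.
- by apply/measurable_EFinP; exact: measurableT_comp.
- by apply/measurable_EFinP; exact: measurableT_comp.
have mA : measurable [set w | 0 <= X w <= 1].
  rewrite (_ : [set _ | _] = X @^-1` `[0, 1]%classic).
    by rewrite -[X in measurable X]setTI; exact: measurable_funP.
  by apply/seteqP; split => w /=; rewrite in_itv.
exists (~` [set w | 0 <= X w <= 1]); split.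
- exact: measurableC.
- by have := probability_setC P mA; rewrite X01 subee.
- move=> w /= /not_implyP[_ h] /andP[h0 h1]; apply: h.
  by rewrite /clamped min_l// max_r.
Qed.

Let integral_clampedE : (\int[P]_w (clamped w)%:E = mu%:E)%E.
Proof. by rewrite -(integral_clamped (f := id))// -EX unlock. Qed.

Lemma expectation01 : 0 <= mu <= 1.
Proof.
apply/andP; split; rewrite -lee_fin -integral_clampedE.
  by apply: integral_ge0 => w _; rewrite lee_fin; case/andP: (clamped01 w).
apply: (@le_trans _ _ (\int[P]_w (1%:E))%E).
  apply: ge0_le_integral => //.
  - by move=> w _; rewrite lee_fin; case/andP: (clamped01 w).
  - exact/measurable_EFinP.
  - by move=> w _; rewrite lee_fin; case/andP: (clamped01 w).
by rewrite integral_cst// mul1e probability_le1.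
Qed.

(** The chord inequality holds everywhere for [clamped], and the integral of the affine chord
    depends only on the mean. *)
Lemma mgf_le_chord (z : R) :
  (\int[P]_w (expR (z * X w))%:E <= (1 + mu * (expR z - 1))%:E)%E.
Proof.
have mexp : measurable_fun setT (fun x : R => expR (z * x)).
  exact: measurable_expRM.
rewrite (integral_clamped mexp).
have ic : P.-integrable setT (EFin \o clamped).
  apply/integrableP; split; first exact/measurable_EFinP.
  rewrite (_ : (fun _ => _) = fun w => (clamped w)%:E).
    by rewrite integral_clampedE ltry.
  by apply/funext => w /=; rewrite ger0_norm//; case/andP: (clamped01 w).
have -> : ((1 + mu * (expR z - 1))%:E =
    \int[P]_w (1 + clamped w * (expR z - 1))%:E)%E.
  under eq_integral => w _ do rewrite EFinD EFinM muleC.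
  rewrite integralD//=; last 2 first.
  - exact: finite_measure_integrable_cst.
  - exact: (integrableZl measurableT).
  rewrite integral_cst// [X in (1 * X)%E](_ : _ = 1%E); last exact: probability_setT.
  rewrite mule1 integralZl//.
  by rewrite integral_clampedE -EFinM -EFinD mulrC.
apply: ge0_le_integral => //.
- by apply/measurable_EFinP; exact: (measurableT_comp mexp).
- apply/measurable_EFinP; apply: measurable_funD => //.
  exact: measurable_funM.
- by move=> w _; rewrite lee_fin; exact: expR_le_chord.
Qed.

End moment_generating.

(** * Suprema of sequences and the Chernoff exponent *)

Lemma ereal_sup_ge0_exists {R : realType} (a : nat -> R) (A : set nat) (e : R) :
  0 < e -> (0 <= ereal_sup [set (a n)%:E | n in A])%E ->
  exists2 n, A n & - e < a n.
Proof.
move=> e0 sup0.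
have /ereal_sup_gt[_ [n An <-]] : ((- e)%:E < ereal_sup [set (a n)%:E | n in A])%E.
  by apply: lt_le_trans sup0; rewrite lte_fin oppr_lt0.
by rewrite lte_fin; exists n.
Qed.

(** The supremum over a tail is a term of the [esups] sequence. Monotonicity of [P] needs this event
    measurable, with [k = 1]. *)
Lemma measurable_sup_ge0 {R : realType} {d : measure_display} {T : measurableType d}
    (a : nat -> T -> R) (k : nat) : (forall n, measurable_fun setT (a n)) ->
  measurable [set w | (0 <= ereal_sup [set (a n w)%:E | n in [set n | (k <= n)%N]])%E].
Proof.
move=> ma; rewrite -[X in measurable X]setTI.
apply: emeasurable_fun_c_infty => //.
apply: (measurable_fun_esups (f := fun n w => (a n w)%:E)) => n.
exact/measurable_EFinP.
Qed.

(** The left side is minus the relative entropy of Bernoulli [theta] with respect to Bernoulli [p];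
    [zeta] is the tilt that minimises the Chernoff exponent on the right. *)
Lemma chernoff_exponentE {R : realType} (p theta : R) : 0 < p < 1 -> 0 < theta < 1 ->
  let zeta := ln (theta * (1 - p) / (p * (1 - theta))) in
  theta * ln (p / theta) + (1 - theta) * ln ((1 - p) / (1 - theta)) =
  ln (p * expR zeta + 1 - p) - theta * zeta.
Proof.
move=> /andP[p0 p1] /andP[t0 t1] zeta.
have p1' : 0 < 1 - p by rewrite subr_gt0.
have t1' : 0 < 1 - theta by rewrite subr_gt0.
have -> : p * expR zeta + 1 - p = (1 - p) / (1 - theta).
  rewrite lnK ?posrE ?divr_gt0 ?mulr_gt0//.
  by field; rewrite !gt_eqF.
rewrite /zeta !ln_div ?posrE ?mulr_gt0// !lnM ?posrE//.
ring.
Qed.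

(** * The maximal inequality applied to the normalised exponentials *)

Theorem theorem15 (R : realType) (d : measure_display) (T : measurableType d)
  (P : probability T R) (X : nat -> {RV P >-> R}) (mu : nat -> R)
  (m : nat) (theta : R) :
  independent_RVs P (fun i => (X i : T -> R)) ->
  (forall i, P [set w | 0 <= X i w <= 1] = 1%E) ->
  (forall i, ('E_P[X i] = (mu i)%:E)%E) ->
  (0 < m)%N ->
  0 < mubar mu m < 1 ->
  0 < theta < 1 ->
  let zeta := ln (theta * (1 - mubar mu m) / (mubar mu m * (1 - theta))) in
  (P [set w | (0 <= ereal_sup
       [set (zeta * (Ssum (fun i => (X i : T -> R)) n w - m%:R * theta)
              - Vfun mu zeta n + Vfun mu zeta m)%:E | n in [set n | (0 < n)%N]])%E]
  <= ((expR (theta * ln (mubar mu m / theta)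
              + (1 - theta) * ln ((1 - mubar mu m) / (1 - theta)))) ^+ m)%:E)%E.
Proof.
move=> indepX X01 EX m0 p01 t01; cbv zeta.
set zeta := ln (theta * (1 - mubar mu m) / (mubar mu m * (1 - theta))).
have mu01 i : 0 <= mu i <= 1 := expectation01 (X01 i) (EX i).
pose D i := 1 + mu i * (expR zeta - 1).
have D0 i : 0 < D i.
  case/andP: (mu01 i) => h0 h1; rewrite /D.
  have := mulr_ge0 h0 (expR_ge0 zeta).
  (* [D i] is the sum of [1 - mu i] and [mu i * expR zeta], both nonnegative; the first is positive
     unless [mu i = 1], and then the second is. *)
  have [->|mu1] := eqVneq (mu i) 1; first by have := expR_gt0 zeta; lra.
  have : mu i < 1 by rewrite lt_neqAle mu1.
  lra.
have D_mean n : (0 < n)%N ->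
    (\sum_(i < n) D i) / n%:R = mubar mu n * expR zeta + 1 - mubar mu n.
  move=> n0; rewrite /D big_split /= sumr_const card_ord -mulr_suml /mubar.
  by field; rewrite pnatr_eq0 -lt0n.
have D_prod n : (0 < n)%N -> \prod_(i < n) D i <= expR (Vfun mu zeta n).
  move=> n0; have := @leif_AGM R 'I_n predT (fun i => D i).
  rewrite /= cardT size_enum_ord D_mean// => /(_ (fun i _ => ltW (D0 i))) h.
  (* [expR (Vfun mu zeta n)] is the [n]-th power of the mean of the [D i], once that mean is known
     to be positive. *)
  rewrite /Vfun expRM_natl lnK; first by apply: (le_trans _ (leif_le h)).
  rewrite posrE -D_mean// divr_gt0 ?ltr0n//.
  case: n n0 {h} => // n _; rewrite big_ord_recl ltr_pwDl//.
  by apply: sumr_ge0 => i _; exact: ltW.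
pose Y i w := expR (zeta * X i w) / D i.
(* [Y i] is a measurable function of [X i], so independence transfers by pulling test sets back
   along [g i]. *)
pose g i (x : R) := expR (zeta * x) / D i.
have mg i : measurable_fun setT (g i).
  by apply: measurable_funM => //; exact: measurable_expRM.
have mY i : measurable_fun setT (Y i) by exact: (measurableT_comp (mg i)).
have Y0 i w : 0 <= Y i w by rewrite divr_ge0 ?expR_ge0 ?ltW.
have indepY : independent_RVs P Y.
  move=> s B us mB; apply: (indepX s (fun i => g i @^-1` B i)) => // i si.
  by rewrite -[X in measurable X]setTI; apply: mg => //; exact: mB.
have EY i : (\int[P]_w (Y i w)%:E <= 1)%E.
  under eq_integral => w _ do rewrite /Y mulrC EFinM.
  have mE : measurable_fun setT (fun w => (expR (zeta * X i w))%:E).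
    by apply/measurable_EFinP; exact: measurable_expRM.
  have Dinv : (0 <= ((D i)^-1)%:E)%E by rewrite lee_fin invr_ge0 ltW.
  rewrite (ge0_integralZl P measurableT mE _ Dinv); last first.
    by move=> w _; rewrite lee_fin expR_ge0.
  rewrite -(@lee_pmul2l _ (D i)%:E) ?lte_fin// muleA -EFinM divff ?gt_eqF// mul1e mule1.
  exact: mgf_le_chord.
have prodY n w : (0 < n)%N ->
    expR (zeta * Ssum (fun i => (X i : T -> R)) n w - Vfun mu zeta n)
      <= \prod_(i < n) Y i w.
  move=> n0; rewrite /Y big_split /= prodfV expRD expRN.
  rewrite /Ssum mulr_sumr expR_sum ler_wpM2l ?prodr_ge0//.
  by rewrite lef_pV2 ?posrE ?expR_gt0 ?prodr_gt0 ?D_prod.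
(* The claimed bound, in the form given by the exponent identity. *)
pose K := expR (Vfun mu zeta m - zeta * (m%:R * theta)).
have K0 : 0 < K := expR_gt0 _.
rewrite chernoff_exponentE// -expRM_natl -/zeta.
rewrite (_ : m%:R * (_ - _) = Vfun mu zeta m - zeta * (m%:R * theta)); last first.
  by rewrite /Vfun; ring.
rewrite -/K; apply/lee_addgt0Pr => e e0.
(* Chosen so that [K * expR eps = K + e]: the additive slack [e] becomes a factor on the level. *)
pose eps := ln (1 + e / K).
have eK : 0 < e / K by rewrite divr_gt0.
have eps0 : 0 < eps by rewrite ln_gt0// ltrDl.
pose c := expR (zeta * (m%:R * theta) - Vfun mu zeta m - eps).
have -> : (K%:E + e%:E)%E = (c^-1)%:E.
  rewrite -EFinD; congr (_%:E).
  rewrite /c -expRN (_ : - _ = Vfun mu zeta m - zeta * (m%:R * theta) + eps); last by ring.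
  rewrite expRD -/K lnK ?posrE ?addr_gt0//.
  by rewrite mulrDr mulr1 mulrCA divff ?mulr1// gt_eqF.
apply: le_trans (maximal_inequality mY Y0 indepY EY (expR_gt0 _)).
have mS n : measurable_fun setT (fun w =>
    zeta * (Ssum (fun i => (X i : T -> R)) n w - m%:R * theta)
      - Vfun mu zeta n + Vfun mu zeta m).
  apply: measurable_funD => //; apply: measurable_funB => //.
  apply: measurable_funM => //; apply: measurable_funB => //.
  exact: measurable_sum.
apply: le_measure; rewrite ?inE.
- exact: measurable_sup_ge0.
- apply: bigcup_measurable => n _; apply: measurable_superlevel.
  exact: measurable_prod.
(* A nonnegative supremum yields an [n] whose bracket exceeds [- eps], which puts the [n]-th product
   above [c]. *)
move=> w /= /(ereal_sup_ge0_exists eps0)[n /= n0 hn].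
exists n => //=; apply: le_trans (prodY n w n0).
by rewrite ler_expR; lra.
Qed.
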